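(* Let $\kappa$ be an ordinal. The following conditions are equivalent: (a) $C_p(\kappa)$ is a $k_{\mathbb{R}}$-space; (b) $\mathrm{cf}(\kappa)\le\omega$; (c) $C_p(\kappa)$ is Fréchet–Urysohn.
   Context: Every ordinal $\kappa$ is identified with the set of all smaller ordinals and carries the order topology generated by its natural well-order. For a Tychonoff space $X$, $C_p(X)$ is the set $C(X)$ of all continuous real-valued functions on $X$ endowed with the topology of pointwise convergence. An ordinal $\kappa$ is a successor if $\kappa=\alpha+1$ for some $\alpha$, and is limit otherwise. The cofinality $\mathrm{cf}(\kappa)$ of a limit ordinal $\kappa$ is the smallest ordinal $\alpha$ which is the order type of a cofinal subset of $\kappa$; if $\kappa$ is a successor ordinal, $\mathrm{cf}(\kappa)=1$. A topological space $Y$ is a $k_{\mathbb{R}}$-space if a function $f:Y\to\mathbb{R}$ is continuous if and only if its restriction $f|_K$ to every compact subset $K$ of $Y$ is continuous. A topological space $Y$ is Fréchet–Urysohn if for every $A\subseteq Y$ and every $y\in\overline{A}$ there is a sequence of points of $A$ converging to $y$. *)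

(* Defs.v *)
From HB Require Import structures.
From mathcomp Require Import all_boot all_order all_algebra.
From mathcomp Require Import all_classical all_reals all_analysis.
From mathcomp Require wochoice.
Import Order.TTheory GRing.Theory Num.Theory.
Import numFieldNormedType.Exports.

Set Implicit Arguments.
Unset Strict Implicit.
Unset Printing Implicit Defensive.

Local Open Scope classical_set_scope.
Local Open Scope order_scope.

(* An ordinal is represented by a well-ordered type of that order type; an
   element of the type stands for a smaller ordinal, namely the order type of
   its strict initial segment. *)
HB.mixin Record Order_isWellOrder d T & Order.Total d T := {
  le_well_order : wochoice.well_order (<=%O : rel T)
}.

#[short(type="wellOrderType")]
HB.structure Definition WellOrder d :=
  { T of Order.Total d T & Order_isWellOrder d T }.

Lemma nat_well_order : wochoice.well_order (<=%O : rel nat).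
Proof.
apply: wochoice.antisymmetric_well_order; first exact: le_anti.
by move=> A exA; case: (ex_minnP exA) => m Am minm; exists m; split.
Qed.

(* [nat] with its usual order represents the ordinal omega *)
HB.instance Definition _ := Order_isWellOrder.Build _ nat nat_well_order.

Section Ordinals.
Context {d e : Order.disp_t}.

(* alpha <= beta: alpha is isomorphic to an initial segment of beta *)
Definition ordinal_le (alpha : wellOrderType d) (beta : wellOrderType e) :=
  exists f : alpha -> beta, {mono f : x y / x <= y} /\
    (forall (x : alpha) (y : beta), y <= f x -> range f y).

Definition is_order_type (alpha : wellOrderType d) (kappa : wellOrderType e)
    (S : set kappa) :=
  exists f : alpha -> kappa, {mono f : x y / x <= y} /\ range f = S.

End Ordinals.

(* kappa = a + 1 = {0, ..., a} *)
Definition is_successor {d} (kappa : wellOrderType d) :=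
  exists a : kappa, [set: kappa] = [set x | x <= a].

Definition cofinal {d} (kappa : wellOrderType d) (S : set kappa) :=
  forall x : kappa, exists2 y, S y & x <= y.

(* gamma = cf(kappa). Zero is a limit ordinal, and cf(0) = 0. *)
Definition is_cofinality {d e} (kappa : wellOrderType d)
    (gamma : wellOrderType e) :=
  (is_successor kappa -> exists c : gamma, [set: gamma] = [set c]) /\
  (~ is_successor kappa ->
     (exists S : set kappa, cofinal S /\ is_order_type gamma S) /\
     (forall e' (beta : wellOrderType e') (S : set kappa),
        cofinal S -> is_order_type beta S -> ordinal_le gamma beta)).

Definition cofinality_le {d e} (kappa : wellOrderType d)
    (beta : wellOrderType e) :=
  exists e' (gamma : wellOrderType e'),
    is_cofinality kappa gamma /\ ordinal_le gamma beta.

(* C(X) as a subspace of the product R^X *)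
Definition Cp (X : topologicalType) (R : realType) : topologicalType :=
  set_type [set f : {ptws X -> R} | continuous (f : X -> R)].

Definition kR_space (R : realType) (Y : topologicalType) :=
  forall f : Y -> R, continuous f <->
    (forall K : set Y, compact K -> {within K, continuous f}).

Definition Frechet_Urysohn (Y : topologicalType) :=
  forall (A : set Y) (y : Y), closure A y ->
    exists2 u : nat -> Y, (forall n, A (u n)) & u @ \oo --> y.

(* Main.v *)
Require Import Defs.
From HB Require Import structures.
From mathcomp Require Import all_boot all_order all_algebra.
From mathcomp Require Import all_classical all_reals all_analysis.
From mathcomp Require wochoice.
From mathcomp Require Import zify lra.
Import Order.TTheory GRing.Theory Num.Theory.
Import numFieldNormedType.Exports.

(** The three conditions are proved equivalent in the cycle (b), (c), (a), (b),
    where (b) is used in the form: some sequence is cofinal in kappa, or kappa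
    is empty ([cofinality_leP]).

    (b) implies (c), [countably_cofinal_Frechet_Urysohn].  Let f be in the
    closure of A.  A closing-off argument builds countably many points
    D of kappa together with functions u_0, u_1, ... of A such that u_n is
    1/(n+1)-close to f on the first points of D, such that D is cofinal, and
    such that D contains, for all j, e > 0 and y in D other than the least
    element of kappa, some b < y for which f - u_j varies by less than e on the
    interval ]b, y].  Given any x, let y be the least element of D with x <= y.
    If x < y, each such b is smaller than x by minimality of y; so f - u_j takes
    the same value at x and at y
    ([eq_at_min_above]).  As u_n converges to f at y, it does so at x.

    (c) implies (a), [Frechet_Urysohn_kR]: a discontinuity is witnessed by
    a convergent sequence, and a convergent sequence together with its limit
    is compact.

    (a) implies (b), by contraposition.  If every sequence is bounded in kappa,
    then every continuous function on kappa is eventually constant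
    ([eventually_constant]).  Sending g to its eventual value is not continuous
    on C_p(kappa), because finitely many points do not control it
    ([eventual_value_discontinuous]); but it is continuous on every compact set
    ([eventual_value_continuous_on_compact]), so C_p(kappa) is not
    a k_R-space. *)

Set Implicit Arguments.
Unset Strict Implicit.
Unset Printing Implicit Defensive.

Local Open Scope classical_set_scope.

(** * Well-orders and cofinality *)

Section WellOrders.
Local Open Scope order_scope.
Context {d : Order.disp_t} {kappa : wellOrderType d}.
Implicit Types (S : set kappa) (x y : kappa) (c : nat -> kappa).

Lemma wo_min S : S !=set0 -> exists2 x, S x & forall y, S y -> x <= y.
Proof.
move=> [x Sx].
have [|z [[Sz minz] _]] := @le_well_order d kappa (mem S).
  by exists x; rewrite inE.
exists z; first by move: Sz; rewrite inE.
by move=> y Sy; apply: minz; rewrite inE.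
Qed.

Lemma wo_sup c y : (forall n, c n <= y) ->
  exists s, (forall n, c n <= s) /\ (forall x, x < s -> exists n, x < c n).
Proof.
move=> cy; have [|s cs mins] := @wo_min [set s | forall n, c n <= s].
  by exists y.
exists s; split=> // x xs; apply: contrapT => /forallNP cx.
move: xs; apply/negP; rewrite -leNgt; apply: mins => n.
by rewrite leNgt; apply/negP.
Qed.

Lemma wo_succ x y : x < y ->
  exists2 s, x < s & forall z, x < z -> s <= z.
Proof. by move=> xy; apply: (@wo_min [set s | x < s]); exists y. Qed.

(** The premise makes the empty order countably cofinal, as cf(0) = 0. *)
Definition countably_cofinal :=
  kappa -> exists c, forall x, exists n, x <= c n.

Lemma not_countably_cofinal : ~ countably_cofinal ->
  exists _ : kappa, forall c, exists x, forall n, c n < x.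
Proof.
move=> ncc; apply: contrapT => k0; apply: ncc => x0.
apply: contrapT => ncc; apply: k0; exists x0.
move=> c; apply: contrapT => ncx; apply: ncc; exists c => x.
apply: contrapT => xc; apply: ncx; exists x => n.
by rewrite ltNge; apply/negP => xcn; apply: xc; exists n.
Qed.

Lemma limit_gt_ex x : ~ is_successor kappa -> exists y, x < y.
Proof.
move=> lim; apply: contrapT => xmax; apply: lim; exists x.
apply/seteqP; split=> // y _ /=; rewrite leNgt; apply/negP => xy.
by apply: xmax; exists y.
Qed.

End WellOrders.
Arguments countably_cofinal {d} kappa.

Lemma ord1_well_order : wochoice.well_order (<=%O : rel 'I_1).
Proof.
apply: wochoice.antisymmetric_well_order; first exact: le_anti.
by move=> A [x Ax]; exists x; split=> // y _; rewrite (ord1 x) (ord1 y).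
Qed.

HB.instance Definition _ := Order_isWellOrder.Build _ 'I_1 ord1_well_order.

Section Cofinality.
Local Open Scope order_scope.

(** Iterating the successor from the least element of beta enumerates an
    initial segment: below the successor of b there is only b and what is
    below b. *)
Lemma omega_le (e : Order.disp_t) (beta : wellOrderType e) (b0 : beta) :
  (forall b : beta, exists b', b < b') ->
  ordinal_le nat beta.
Proof.
move=> nomax.
have [bot _ botP] := @wo_min _ beta setT (ex_intro _ b0 I).
have /choice[s sP] (b : beta) :
    exists s, b < s /\ forall z, b < z -> s <= z.
  by have [b' /wo_succ[s]] := nomax b; exists s.
pose g n := iter n s bot.
have glt : {homo g : m n / (m < n)%N >-> m < n}.
  by apply: homo_ltn => [y x z /lt_trans|n]; [apply|exact: (sP _).1].
exists g; split; first exact: le_mono.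
move=> x y; elim: x => [|n IHn] yg.
  by exists 0%N => //; apply/le_anti; rewrite yg botP.
have [/IHn//|gy] := leP y (g n).
by exists n.+1 => //; apply/le_anti; rewrite yg /= (sP _).2.
Qed.

(** A nonempty set whose order type embeds in omega is the range of a sequence.
    Conversely cf(kappa) is 1, 0 or omega: a sequence that is cofinal in
    a nonempty kappa without a maximum can be made strictly increasing, which
    gives a cofinal set of type omega, and no cofinal set can be shorter because
    none has a maximum. *)
Lemma cofinality_leP (d : Order.disp_t) (kappa : wellOrderType d) :
  cofinality_le kappa nat <-> countably_cofinal kappa.
Proof.
split.
- move=> [e [gamma [[csucc clim] [f [fmono _]]]]] x0.
  have [[a aP]|lim] := pselect (is_successor kappa).
    exists (fun=> a) => x; exists 0%N.
    by have : [set: kappa] x by []; rewrite aP.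
  have [[S [cofS [g [gmono gS]]]] _] := clim lim.
  pose c n := if pselect (exists a, f a = n) is left h
              then g (projT1 (cid h)) else x0.
  exists c => x; have [y] := cofS x; rewrite -gS => -[a _ <-] xga.
  exists (f a); rewrite /c; case: pselect => [h|[]]; last by exists a.
  by case: cid => b /= /(inc_inj fmono) ->.
move=> ccof.
have [[a aP]|lim] := pselect (is_successor kappa).
  exists _, 'I_1; split; first split.
    - by exists ord0; apply/seteqP; split=> // i _; exact: ord1.
    - by case; exists a.
  exists (fun=> 0%N); split; first by move=> x y; rewrite (ord1 x) (ord1 y).
  by move=> _ [|//] _; exists ord0.
have [[x0 _]|k0] := pselect (exists x : kappa, True); last first.
  exists _, kappa; split; first split=> [[a _]|_]; first by case: k0; exists a.
    split.
      exists setT; split; first by move=> x; exists x.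
      by exists id; split=> //; apply/seteqP; split=> // x _; exists x.
    move=> e' beta S _ _.
    by exists (fun x => False_rect _ (k0 (ex_intro _ x I))); split => x;
      case: k0; exists x.
  by exists (fun=> 0%N); split => x; case: k0; exists x.
have [c cP] := ccof x0.
have /choice[s sP] (p : kappa * kappa) : exists y, p.1 < y /\ p.2 < y.
  have [y py] := limit_gt_ex (Order.max p.1 p.2) lim.
  by exists y; move: py; rewrite gt_max => /andP[].
pose g := fix g n := if n is m.+1 then s (g m, c m) else x0.
have glt : {homo g : m n / (m < n)%N >-> m < n}.
  by apply: homo_ltn => [y x z /lt_trans|n]; [apply|exact: (sP (_, _)).1].
exists _, nat; split; last first.
  by exists id; split=> // x y _; exists y.
split=> [//|_]; split.
  exists (range g); split.
    move=> x; have [n xc] := cP x; exists (g n.+1); first by exists n.+1.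
    exact/(le_trans xc)/ltW/(sP (_, _)).2.
  by exists g; split=> //; exact: le_mono.
move=> e' beta S cofS [f [fmono fS]].
have [y0 + _] := cofS x0; rewrite -fS => -[b0 _ _].
apply: (omega_le b0) => b.
have [y fby] := limit_gt_ex (f b) lim.
have [z] := cofS y; rewrite -fS => -[b' _ <-] yfb'.
by exists b'; rewrite -(leW_mono fmono); exact: lt_le_trans yfb'.
Qed.

End Cofinality.

Local Open Scope ring_scope.

(** * The topology of pointwise convergence *)

Lemma lt_inv_succ (R : realType) (e : R) : 0 < e ->
  exists N, forall n, (N <= n)%N -> n.+1%:R^-1 < e.
Proof.
move=> e0; have [N _ NP] := near_infty_natSinv_lt (PosNum e0).
by exists N => n /NP.
Qed.

Section Pointwise.
Context {R : realType} {X : topologicalType}.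
Implicit Types (f g : Cp X R) (x : X) (s : seq X) (e : R).

Definition basic_nbhs f s e : set (Cp X R) :=
  [set g | forall x, x \in s -> `|\val f x - \val g x| < e].

Lemma Cp_continuous f : continuous (\val f : X -> R).
Proof. by have := valP f; rewrite inE. Qed.

Lemma near_eval f x e : 0 < e ->
  \forall g \near f, `|\val f x - \val g x| < e.
Proof.
move=> e0; have : (fun g : Cp X R => \val g x) @ f --> \val f x.
  apply: (@continuous_comp _ _ _ (\val : Cp X R -> {ptws X -> R})
                           (fun h => h x)).
    exact: initial_continuous.
  exact: (@proj_continuous X (fun=> R) x).
by move/cvgrPdist_lt; apply.
Qed.

Lemma basic_nbhsP f s e : 0 < e -> nbhs f (basic_nbhs f s e).
Proof.
move=> e0; elim: s => [|x s IHs].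
  by apply: filterS (filterT) => g _ x; rewrite in_nil.
apply: filterS (filterI (near_eval f x e0) IHs) => g [gx gs] y.
by rewrite inE => /predU1P[->//|]; exact: gs.
Qed.

Lemma Cp_cvgP (F : set_system (Cp X R)) f : Filter F ->
  F --> f <-> forall x e, 0 < e -> F [set g | `|\val f x - \val g x| < e].
Proof.
move=> FF; split=> [Ff x e e0|Ff]; first exact/Ff/near_eval.
have Fptws : \val @ F --> (\val f : {ptws X -> R}).
  apply/cvg_sup => x U [_ [[W oW <-] Wfx] WU].
  apply: (filterS WU).
  have /nbhs_ballP[e /= e0 eW] : nbhs (\val f x) W.
    by apply: open_nbhs_nbhs; split.
  suff : F [set g | W (\val g x)] by [].
  by apply: filterS (Ff x e e0) => g gxe; apply: eW; rewrite -ball_normE.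
move=> U [_ [[W oW <-] Wf] WU]; apply: (filterS WU).
by apply: Fptws; apply: open_nbhs_nbhs; split.
Qed.

(** The sets that contain some [basic_nbhs f s e] form a filter; it converges
    to f by the criterion [Cp_cvgP], hence refines the neighbourhoods of f. *)
Lemma Cp_nbhs_basic f (U : set (Cp X R)) : nbhs f U ->
  exists s, exists2 e, 0 < e & basic_nbhs f s e `<=` U.
Proof.
pose F : set_system (Cp X R) :=
  [set V | exists s, exists2 e, 0 < e & basic_nbhs f s e `<=` V].
have FF : Filter F.
  split.
  - by exists [::], 1.
  - move=> V W [s [a a0 sV]] [t [b b0 tW]].
    exists (s ++ t), (Num.min a b); first by rewrite lt_min a0.
    move=> g gst; split; [apply: sV|apply: tW] => x xs.
    + by have := gst x; rewrite mem_cat xs lt_min => /(_ isT)/andP[].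
    + by have := gst x; rewrite mem_cat xs orbT lt_min => /(_ isT)/andP[].
  - by move=> V W VW [s [e e0 sV]]; exists s, e => // g /sV/VW.
suff : F --> f by move=> + fU; apply.
apply/Cp_cvgP => x e e0; exists [:: x], e => // g; apply.
exact: mem_head.
Qed.

End Pointwise.

(** * Fréchet-Urysohn spaces are k_R-spaces *)

(** A filter on this set that does not cluster at y avoids a neighbourhood of y,
    so it lives on finitely many terms of the sequence. *)
Lemma compact_cvg_seq (Y : topologicalType) (u : nat -> Y) (y : Y) :
  u @ \oo --> y -> compact (y |` range u).
Proof.
move=> uy F FF FK; apply: contrapT => nclF.
have /existsNP[B /not_implyP[FB /existsNP[U /not_implyP[yU BU0]]]] :
    ~ forall B, F B -> forall U, nbhs y U -> B `&` U !=set0.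
  move=> yF; apply: nclF; exists y; split; first by left.
  by move=> B U FB yU; exact: yF.
have [N _ NU] := uy _ yU.
have [||z [[n _ <-] clz]] := @finite_compact _ (u @` `I_N) _ F.
- exact/finite_image/finite_II.
- apply: filterS (filterI FK FB) => _ [[->|[n _ <-]] Bn].
    by case: BU0; exists y; split=> //; exact: nbhs_singleton.
  exists n => //=; rewrite ltnNge; apply/negP => /NU/= Un.
  by apply: BU0; exists (u n).
by apply: nclF; exists (u n); split => //; right; exists n.
Qed.

Lemma Frechet_Urysohn_kR (R : realType) (Y : topologicalType) :
  Frechet_Urysohn Y -> kR_space R Y.
Proof.
move=> FUY f; split=> [fc K _|fK]; first exact: continuous_subspaceT.
move=> y; apply/cvgrPdist_lt => e e0; apply: contrapT => nfy.
have [U yU|u uA uy] := FUY [set z | e <= `|f y - f z|] y.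
  apply: contrapT => AU; apply: nfy; apply: filterS yU => z Uz.
  by rewrite ltNge; apply/negP => fz; apply: AU; exists z.
have := fK _ (compact_cvg_seq uy).
move=> /subspace_continuousP/(_ y (or_introl erefl))/cvgrPdist_lt/(_ e e0) Ky.
have [N _ /(_ N (leqnn N))/=] := uy _ Ky.
have Ku : (y |` range u) (u N) by right; exists N.
by move=> /(_ Ku); apply/negP; rewrite -leNgt; exact: uA.
Qed.

(** * Continuous functions on an ordinal *)

Section OrderTopology.
Context {R : realType} {d : Order.disp_t} {kappa : wellOrderType d}.
Local Notation X := (order_topology kappa).
Implicit Types (x y z : kappa) (c : nat -> kappa).

Lemma left_continuity (f : X -> R) y z (e : R) : continuous f ->
  (z < y)%O -> 0 < e ->
  exists2 b, (b < y)%O & forall x, (b < x)%O -> (x <= y)%O -> `|f y - f x| < e.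
Proof.
move=> fc zy e0; have /cvgrPdist_lt/(_ e e0) := fc y.
rewrite nearE itv_nbhsE => -[[[[] a|lb] r]] [iopen yi] iP.
- by have := itv_open_ends_lside iopen.
- move: yi; rewrite itv_boundlr bnd_simp => /andP[ay yr].
  exists a => // x ax xy; apply: (iP x).
  by rewrite /= itv_boundlr bnd_simp ax (le_trans _ yr)// bnd_simp.
- move: yi; rewrite itv_boundlr => /andP[ly yr].
  exists z => // x _ xy; apply: (iP x).
  rewrite /= itv_boundlr (itv_open_ends_linfty iopen).
  by rewrite (le_trans _ yr)// bnd_simp.
Qed.

(** The initial segment [0, b] is clopen: it is the open ray below the successor
    of b. *)
Lemma step_continuous b z : (b < z)%O ->
  continuous ((fun x => if (x <= b)%O then 0 else 1) : X -> R).
Proof.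
move=> /wo_succ[s bs sP] x.
apply: (@cvg_near_cst _ _ _ _ _ (nbhs_filter (x : X))).
have [xb|bx] := leP x b.
  have : nbhs (x : X) [set` `]-oo, s[%O].
    apply: open_nbhs_nbhs; split; first exact: lray_open.
    by rewrite /= in_itv /= (le_lt_trans xb).
  move=> Ux; apply: filterS Ux => y; rewrite /= in_itv /= => ys.
  have [//|by_] := leP y b.
  by move: ys; rewrite ltNge sP.
have : nbhs (x : X) [set` `]b, +oo[%O].
  apply: open_nbhs_nbhs; split; first exact: rray_open.
  by rewrite /= in_itv /= bx.
move=> Ux; apply: filterS Ux => y.
by rewrite /= in_itv /= andbT => /lt_geF ->.
Qed.

Lemma continuous_sup_eq (f g : X -> R) c y : continuous f -> continuous g ->
  (forall n, c n <= y)%O -> (forall x, x < y -> exists n, x < c n)%O ->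
  (forall n, f (c n) = g (c n)) -> f y = g y.
Proof.
move=> fc gc cy yc fg; have [yle|] := pselect (forall x, y <= x)%O.
  by have -> : y = c 0%N by apply/le_anti; rewrite yle cy.
move=> /existsNP[z /negP]; rewrite -ltNge => zy.
have hc : continuous (fun x : X => f x - g x).
  by move=> x; exact: (continuousB (fc x) (gc x)).
apply/eqP; rewrite -subr_eq0 -normr_eq0; apply/negPn/negP => h0.
have h_gt0 : 0 < `|f y - g y| by rewrite lt_def h0 normr_ge0.
have [b /yc[n bcn] bP] := left_continuity hc zy h_gt0.
have := bP (c n) bcn (cy n).
by rewrite fg subrr subr0 ltxx.
Qed.

(** If x < y, then the points b of D lie below x by minimality of y, so x belongs
    to the intervals ]b, y] on which h is nearly constant. *)
Lemma eq_at_min_above (D : set kappa) (h : X -> R) x y : (x <= y)%O ->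
  (forall z, D z -> (x <= z)%O -> (y <= z)%O) ->
  ((x < y)%O -> forall e, 0 < e -> exists2 b, D b & (b < y)%O /\
     forall t, (b < t)%O -> (t <= y)%O -> `|h y - h t| < e) ->
  h x = h y.
Proof.
rewrite le_eqVlt => /predU1P[->//|xy] ymin /(_ xy) hD.
apply/eqP; rewrite eq_sym -subr_eq0 -normr_eq0; apply/negPn/negP => h0.
have h_gt0 : 0 < `|h y - h x| by rewrite lt_def h0 normr_ge0.
have [b Db [bey bP]] := hD _ h_gt0.
have bx : (b < x)%O.
  by rewrite ltNge; apply/negP => /(ymin b Db); rewrite leNgt bey.
by have := bP x bx (ltW xy); rewrite ltxx.
Qed.

End OrderTopology.

(** * Countable cofinality: C_p is Fréchet-Urysohn *)

Section CountableCofinality.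
Context (R : realType) {d : Order.disp_t} {kappa : wellOrderType d}.
Local Notation X := (order_topology kappa).

Lemma countably_cofinal_Frechet_Urysohn :
  countably_cofinal kappa -> Frechet_Urysohn (Cp X R).
Proof.
move=> ccof A f fA.
have /choice[G GP] (p : seq X * nat) :
    exists g, A g /\ basic_nbhs f p.1 p.2.+1%:R^-1 g.
  have p0 : 0 < p.2.+1%:R^-1 :> R by rewrite invr_gt0.
  by have [g [Ag gf]] := fA _ (basic_nbhsP f p.1 p0); exists g.
have [[x0 _]|k0] := pselect (exists x : kappa, True); last first.
  exists (fun=> G ([::], 0%N)); first by move=> n; exact: (GP _).1.
  by apply/Cp_cvgP => x; case: k0; exists x.
have [c cP] := ccof x0.
(* The least element of kappa has no b below it; hence the guard z < y. *)
have /choice[b bP] (p : kappa * Cp X R * nat) : exists b, forall z,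
    (z < p.1.1 -> b < p.1.1 /\ forall x, b < x -> x <= p.1.1 ->
    (`|(\val f p.1.1 - \val p.1.2 p.1.1) - (\val f x - \val p.1.2 x)|
      < p.2.+1%:R^-1)%R)%O.
  case: p => [[y g] n] /=.
  have [[z zy]|nz] := pselect (exists z, z < y)%O; last first.
    by exists y => z zy; case: nz; exists z.
  have hc : continuous (fun x : X => \val f x - \val g x).
    move=> x.
    exact: (continuousB (@Cp_continuous _ _ f x) (@Cp_continuous _ _ g x)).
  have n0 : 0 < n.+1%:R^-1 :> R by rewrite invr_gt0.
  have [a ay aP] := left_continuity hc zy n0.
  by exists a => z' _; split.
(* The state after n steps is the list of the points chosen so far and the list
   of the functions u_0, ..., u_(n-1).  Each step treats all the pairs listed so
   far with precision 1/(n+1), so every pair is treated with every precision. *)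
pose new (D : seq X) L n := c n :: [seq b (y, h, n) | y <- D, h <- L].
pose st := fix st n : seq X * seq (Cp X R) := if n is m.+1 then
    ((st m).1 ++ new (st m).1 (st m).2 m, G ((st m).1, m) :: (st m).2)
  else ([::], [::]).
pose u n := G ((st n).1, n).
have Dmono m n : (m <= n)%N -> {subset (st m).1 <= (st n).1}.
  move=> /subnK <-; elim: (n - m)%N => [//|k IHk] x /IHk xk.
  by rewrite addSn /= mem_cat xk.
have Lu j n : (j < n)%N -> u j \in (st n).2.
  elim: n => [//|n IHn]; rewrite ltnS leq_eqVlt => /predU1P[->|/IHn jn].
    exact: mem_head.
  by rewrite inE jn orbT.
have Dc n : c n \in (st n.+1).1 by rewrite /= mem_cat inE eqxx orbT.
have Db m j n y : y \in (st m).1 -> (m <= n)%N -> (j < n)%N ->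
    b (y, u j, n) \in (st n.+1).1.
  move=> ym mn jn; rewrite /= mem_cat inE.
  by rewrite (allpairs_f (fun y h => b (y, h, n))) ?orbT ?Lu ?(Dmono m n).
exists u; first by move=> n; exact: (GP _).1.
apply/Cp_cvgP => x e e0.
pose D : set kappa := [set y | exists m, y \in (st m).1].
have [|y [[m ym] xy] ymin] := @wo_min _ _ [set y | D y /\ (x <= y)%O].
  by have [n xc] := cP x; exists (c n); split=> //; exists n.+1.
have xyE j : \val f x - \val (u j) x = \val f y - \val (u j) y.
  apply: (@eq_at_min_above R _ _ D (fun t => \val f t - \val (u j) t) _ _ xy).
    by move=> z Dz xz; apply: ymin.
  move=> x_lt_y a a0; have [N NP] := lt_inv_succ a0.
  pose n := (N + m + j.+1)%N.
  exists (b (y, u j, n)).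
    by exists n.+1; apply: (Db m) => //; rewrite /n; lia.
  have [/= bey bne] := bP (y, u j, n) x x_lt_y; split=> // t bt ty.
  by apply: lt_trans (bne t bt ty) (NP n _); rewrite /n; lia.
have [N NP] := lt_inv_succ e0.
exists (N + m)%N => // n /= Nmn.
rewrite xyE; apply: lt_trans (NP n _); last by lia.
by apply: (GP _).2 => /=; apply: Dmono ym; lia.
Qed.

End CountableCofinality.

(** * Uncountable cofinality: C_p is not a k_R-space *)

Section UncountableCofinality.
Context (R : realType) {d : Order.disp_t} {kappa : wellOrderType d}.
Local Notation X := (order_topology kappa).
Implicit Types (c : nat -> kappa) (f : X -> R) (g h : Cp X R).
Context (x0 : kappa) (bounded : forall c, exists x, forall n, (c n < x)%O).

(** Otherwise there is an increasing sequence along which f moves by at least e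
    at each step, and f is not continuous at its supremum. *)
Lemma eventually_small_oscillation f (e : R) : continuous f -> 0 < e ->
  exists y, forall x, (y < x)%O -> `|f y - f x| < e.
Proof.
move=> fc e0; apply: contrapT => nf.
have /choice[s sP] (y : kappa) : exists x, (y < x)%O /\ e <= `|f y - f x|.
  apply: contrapT => ny; apply: nf; exists y => x yx.
  by rewrite ltNge; apply/negP => fx; apply: ny; exists x.
pose c n := iter n s x0.
have [w wP] := bounded c.
have [|y [cy yc]] := @wo_sup _ _ c w; first by move=> n; exact/ltW.
have e2 : 0 < e / 2 by rewrite divr_gt0.
have c0y : (c 0%N < y)%O := lt_le_trans (sP (c 0%N)).1 (cy 1%N).
have [b by_ bP] := left_continuity fc c0y e2.
have [n bcn] := yc b by_.
have cS : (c n < c n.+1)%O := (sP (c n)).1.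
have := bP _ bcn (cy n); have := bP _ (lt_trans bcn cS) (cy n.+1).
have := (sP (c n)).2; rewrite -/(c n.+1) => dist h1 h2.
have := ler_distD (f y) (f (c n)) (f (c n.+1)).
rewrite (distrC (f (c n)) (f y)); lra.
Qed.

Lemma eventually_constant f : continuous f ->
  exists y, forall x, (y <= x)%O -> f x = f y.
Proof.
move=> fc.
have /choice[c cP] (n : nat) :
    exists y, forall x, (y < x)%O -> `|f y - f x| < n.+1%:R^-1.
  by apply: eventually_small_oscillation => //; rewrite invr_gt0.
have [y yP] := bounded c; exists y => x yx.
apply/eqP; rewrite -subr_eq0 -normr_eq0; apply/negPn/negP => h0.
have h_gt0 : 0 < `|f x - f y| / 2 by rewrite divr_gt0 // lt_def h0 normr_ge0.
have [N NP] := lt_inv_succ h_gt0.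
have := NP N (leqnn N); have := cP N x (lt_le_trans (yP N) yx).
have := cP N y (yP N); have := ler_distD (f (c N)) (f x) (f y).
rewrite (distrC (f x) (f (c N))); move: (N.+1%:R^-1 : R) => i; lra.
Qed.

Definition eventual_value (F : Cp X R -> R) :=
  forall g, exists y : kappa, forall x, (y <= x)%O -> \val g x = F g.

Lemma eventual_value_exists : exists F, eventual_value F.
Proof.
have /choice[T TP] (g : Cp X R) :
    exists y : kappa, forall x, (y <= x)%O -> \val g x = \val g y.
  by have [y yP] := eventually_constant (@Cp_continuous _ _ g); exists y.
by exists (fun g => \val g (T g)) => g; exists (T g); exact: TP.
Qed.

(** Suppose that F is not continuous at g relative to K.  Choose h_n in K with
    F h_n at distance at least e from F g and h_n ever closer to g on the points
    c_0, ..., c_n, where g is constant from c_0 on and h_m from c_(m+1) on.  Let y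
    be the supremum of the c_n and let k in K be a cluster point of the h_n.  Then
    k and g agree at each c_n, hence at y by continuity of k and g.  But
    h_n y = F h_n and g y = F g differ by at least e for all n, and so do
    k y and g y. *)
Lemma eventual_value_continuous_on_compact F (K : set (Cp X R)) :
  eventual_value F -> compact K -> {within K, continuous F}.
Proof.
move=> /choice[T FE] cK; apply/subspace_continuousP => g Kg.
apply/cvgrPdist_lt => e e0; apply: contrapT => nF.
have /choice[H HP] (p : seq X * nat) : exists h,
    [/\ K h, basic_nbhs g p.1 p.2.+1%:R^-1 h & e <= `|F g - F h|].
  have p0 : 0 < p.2.+1%:R^-1 :> R by rewrite invr_gt0.
  apply: contrapT => nh; apply: nF.
  apply: filterS (basic_nbhsP g p.1 p0) => h gh Kh.
  by rewrite /= ltNge; apply/negP => Fgh; apply: nh; exists h.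
pose st := fix st n : seq X :=
  if n is m.+1 then T (H (st m, m)) :: st m else [:: T g].
pose h n := H (st n, n).
pose c n := if n is m.+1 then T (h m) else T g.
have c_st i n : (i <= n)%N -> c i \in st n.
  elim: n => [|n IHn]; first by rewrite leqn0 => /eqP->; exact: mem_head.
  rewrite leq_eqVlt => /predU1P[->|/IHn cn]; first exact: mem_head.
  by rewrite inE cn orbT.
have [w wP] := bounded c.
have [|y [cy yc]] := @wo_sup _ _ c w; first by move=> n; exact/ltW.
have [|k [Kk clk]] := @cK (h @ \oo) _.
  by exists 0%N => // n _; case: (HP (st n, n)).
have cluster_close x (eps : R) N : 0 < eps ->
    exists2 n, (N <= n)%N & `|\val k x - \val (h n) x| < eps.
  move=> eps0.
  have [|_ [[n Nn <-] hn]] :=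
      clk (h @` [set n | (N <= n)%N]) _ _ (near_eval k x eps0).
    by exists N => // n Nn; exists n.
  by exists n.
have kgc n : \val k (c n) = \val g (c n).
  apply/eqP; rewrite -subr_eq0 -normr_eq0; apply/negPn/negP => h0.
  have h_gt0 : 0 < `|\val k (c n) - \val g (c n)| / 2.
    by rewrite divr_gt0 // lt_def h0 normr_ge0.
  have [N NP] := lt_inv_succ h_gt0.
  have [m Nm km] := cluster_close (c n) _ (maxn N n) h_gt0.
  have := NP m (leq_trans (leq_maxl _ _) Nm).
  have c_in : c n \in st m := c_st _ _ (leq_trans (leq_maxr _ _) Nm).
  have [_ /(_ (c n) c_in) + _] := HP (st m, m).
  rewrite -/(h m) /=.
  have := ler_distD (\val (h m) (c n)) (\val k (c n)) (\val g (c n)).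
  rewrite (distrC (\val (h m) (c n))); move: (m.+1%:R^-1 : R) => i; lra.
have kgy : \val k y = \val g y.
  apply: continuous_sup_eq cy yc kgc; exact: Cp_continuous.
have [n _] := cluster_close y e 0%N e0.
rewrite kgy (FE g y (cy 0%N)) (FE (h n) y (cy n.+1)).
by apply/negP; rewrite -leNgt; case: (HP (st n, n)).
Qed.

(** A function that is 0 up to a large b and 1 beyond b is close to the zero
    function at finitely many prescribed points. *)
Lemma eventual_value_discontinuous F : eventual_value F -> ~ continuous F.
Proof.
move=> FP Fc.
have zc : continuous ((fun=> 0) : X -> R) by exact: cst_continuous.
pose z : Cp X R := SigSub
  (mem_set zc : _ \in [set f : {ptws X -> R} | continuous (f : X -> R)]).
have := Fc z => /cvgrPdist_lt/(_ 1 ltr01)/Cp_nbhs_basic[s [e e0 sF]].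
have [b sb] : exists b : kappa, forall x : kappa, x \in s -> (x <= b)%O.
  elim: s {sF} => [|x s [b sb]]; first by exists x0.
  exists (Order.max x b) => y; rewrite inE le_max => /predU1P[->|/sb->].
    by rewrite lexx.
  by rewrite orbT.
have [b' /(_ 0%N) bb'] := bounded (fun=> b).
have fc := @step_continuous R _ _ _ _ bb'.
pose f : Cp X R := SigSub
  (mem_set fc : _ \in [set f : {ptws X -> R} | continuous (f : X -> R)]).
have /sF : basic_nbhs z s e f.
  by move=> x /sb xb; rewrite /= xb subrr normr0.
have [yf Ff] := FP f; have [yz Fz] := FP z.
have bm : (b < Order.max yf b')%O by rewrite lt_max bb' orbT.
rewrite /= -(Fz yz (lexx _)) -(Ff (Order.max yf b')) ?le_max ?lexx//=.
by rewrite leNgt bm /= sub0r normrN normr1 ltxx.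
Qed.

Lemma not_kR_Cp : ~ kR_space R (Cp X R).
Proof.
have [F FP] := eventual_value_exists.
move=> kR; apply: (eventual_value_discontinuous FP); apply/kR => K.
exact: eventual_value_continuous_on_compact.
Qed.

End UncountableCofinality.

Theorem theorem1p2 (R : realType) (d : Order.disp_t)
    (kappa : wellOrderType d) :
  (kR_space R (Cp (order_topology kappa) R) <-> cofinality_le kappa nat) /\
  (cofinality_le kappa nat <-> Frechet_Urysohn (Cp (order_topology kappa) R)).
Proof.
have ab : kR_space R (Cp (order_topology kappa) R) -> cofinality_le kappa nat.
  move=> kR; apply/cofinality_leP; apply: contrapT.
  by move=> /not_countably_cofinal[x0 bounded]; apply: not_kR_Cp kR.
have bc : cofinality_le kappa nat ->
    Frechet_Urysohn (Cp (order_topology kappa) R).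
  by move=> /cofinality_leP; exact: countably_cofinal_Frechet_Urysohn.
by split; split=> // h; [exact/Frechet_Urysohn_kR/bc|exact/ab/Frechet_Urysohn_kR].
Qed.
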